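(* Let $\mathcal{G}=(A,(\preceq_i)_{i\in\mathcal{P}})$ be a game whose preference relations are all $\omega$-recognizable total preorders. Then from every initial vertex there exists a Nash equilibrium.
   Context: An arena is $A=(V,E,\mathcal{P},(V_i)_i)$ with finite vertex set $V$, edges $E$ (every vertex has a successor), finite player set $\mathcal{P}$ and partition $(V_i)_i$. A relation on $V^\omega$ is $\omega$-recognizable if it equals $\bigcup_k X_k\times Y_k$ with $X_k,Y_k$ $\omega$-regular; a total preorder is reflexive, transitive, and any two words are comparable. Let $x\prec_i y$ iff $x\preceq_i y$ and $y\not\preceq_i x$. A Nash equilibrium from $v_0$ is a strategy profile $\sigma$ such that for every player $i$ and every strategy $\tau_i$ of player $i$, $\langle\sigma\rangle_{v_0}\not\prec_i\langle\tau_i,\sigma_{-i}\rangle_{v_0}$, where $\langle\cdot\rangle_{v_0}$ denotes the outcome from $v_0$. *)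

(* Defs.v *)
From mathcomp Require Import all_boot.
Set Implicit Arguments. Unset Strict Implicit. Unset Printing Implicit Defensive.

Definition word (V : Type) := nat -> V.

Record buchi (V : finType) := Buchi {
  bstate : finType;
  binit : pred bstate;
  btrans : bstate -> V -> bstate -> bool;
  bacc : pred bstate }.

Definition buchi_accepts (V : finType) (B : buchi V) (w : word V) : Prop :=
  exists r : nat -> bstate B,
    [/\ @binit V B (r 0),
        (forall n, @btrans V B (r n) (w n) (r n.+1)) &
        (forall m, exists2 n, m <= n & @bacc V B (r n))].

Definition omega_regular (V : finType) (L : word V -> Prop) : Prop :=
  exists B : buchi V, forall w, L w <-> buchi_accepts B w.

Definition omega_recognizable (V : finType) (R : word V -> word V -> Prop) : Prop :=
  exists (n : nat) (X Y : nat -> word V -> Prop),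
    (forall k, k < n -> omega_regular (X k) /\ omega_regular (Y k)) /\
    (forall x y, R x y <-> exists2 k, k < n & X k x /\ Y k y).

Definition total_preorder (T : Type) (R : T -> T -> Prop) : Prop :=
  [/\ (forall x, R x x),
      (forall x y z, R x y -> R y z -> R x z) &
      (forall x y, R x y \/ R y x)].

Definition strict_of (T : Type) (R : T -> T -> Prop) (x y : T) : Prop :=
  R x y /\ ~ R y x.

(* Arena: V finite vertices, E edge relation (every vertex has a successor),
   P finite players, owner v = the player i with v \in V_i. *)
Definition arena_ok (V : finType) (E : rel V) : Prop :=
  forall v, exists v', E v v'.

(* A strategy maps a history (nonempty sequence of vertices, ending in the
   current vertex) to the next vertex. *)
Definition strategy (V : finType) := seq V -> V.

Definition valid_strategy (V P : finType) (E : rel V) (owner : V -> P)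
  (i : P) (s : strategy V) : Prop :=
  forall (h : seq V) (v : V), owner v = i -> E v (s (rcons h v)).

Definition profile (V P : finType) := P -> strategy V.

Definition valid_profile (V P : finType) (E : rel V) (owner : V -> P)
  (sigma : profile V P) : Prop :=
  forall i, valid_strategy E owner i (sigma i).

Fixpoint play_hist (V P : finType) (owner : V -> P) (sigma : profile V P)
  (v0 : V) (n : nat) : seq V :=
  match n with
  | 0 => [:: v0]
  | n'.+1 => let h := play_hist owner sigma v0 n' in
             rcons h (sigma (owner (last v0 h)) h)
  end.

Definition outcome (V P : finType) (owner : V -> P) (sigma : profile V P)
  (v0 : V) : word V :=
  fun n => last v0 (play_hist owner sigma v0 n).

Definition deviate (V P : finType) (sigma : profile V P) (i : P)
  (tau : strategy V) : profile V P :=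
  fun j => if j == i then tau else sigma j.

Definition nash_equilibrium (V P : finType) (E : rel V) (owner : V -> P)
  (pref : P -> word V -> word V -> Prop) (sigma : profile V P) (v0 : V) : Prop :=
  valid_profile E owner sigma /\
  forall (i : P) (tau : strategy V), valid_strategy E owner i tau ->
    ~ strict_of (pref i) (outcome owner sigma v0)
                         (outcome owner (deviate sigma i tau) v0).

(* Main.v *)
Require Import Defs.
From mathcomp Require Import all_boot.
From mathcomp Require Import boolp.
Set Implicit Arguments. Unset Strict Implicit. Unset Printing Implicit Defensive.

(* An omega-recognizable total preorder has finitely many classes, so it is given by
   a bounded integer rank whose upper sets are omega-regular. By a Ramsey argument on
   transition profiles, an omega-regular set is a countable union of sets of the form
   "infinitely many prefixes lie in W", so the zero-sum games in which a player tries
   to force rank >= c against the coalition of the others are determined by Davis's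
   theorem for Sigma^0_3 games. Every history thus has a value for every player. In the
   equilibrium each player follows an optimal strategy and switches to a new one each
   time her value increases; the outcome is then at least as good for her as the value
   of each of its prefixes. A player leaving the outcome is held by the coalition to
   the value of the history at which she deviated. *)

(** * Determinacy of games with a countable union of Buchi objectives *)

Definition infinitely_often (J : nat -> Prop) := forall m, exists2 n, m <= n & J n.

Lemma ex_least (J : nat -> Prop) : (exists n, J n) ->
  exists2 n, J n & forall m, m < n -> ~ J m.
Proof.
move=> [n Jn]; have exJ : exists n, `[< J n >] by exists n; apply/asboolP.
exists (ex_minn exJ); case: ex_minnP => m /asboolP Jm min_m //.
by move=> k ltkm /asboolP /min_m; rewrite leqNgt ltkm.
Qed.

Section Games.
Variables (V : finType) (turn : seq V -> bool).
Implicit Types (w : word V) (h p x y : seq V) (b : bool) (T U : seq V -> Prop) (s : strategy V).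

(* Histories are stored latest vertex first, so that h is extended to v :: h. *)
Fixpoint pre w n : seq V := if n is m.+1 then w m :: pre w m else [::].

Lemma size_pre w n : size (pre w n) = n.
Proof. by elim: n => //= n ->. Qed.

Lemma pre_agree w w' n m : pre w n = pre w' n -> m <= n -> pre w m = pre w' m.
Proof.
elim: n => [|n IHn] /=; first by rewrite leqn0 => _ /eqP->.
move=> [eqn eqp]; rewrite leq_eqVlt => /orP[/eqP->/=|/IHn]; first by rewrite eqn eqp.
exact.
Qed.

Lemma eq_pre w w' n : (forall m, m < n -> w m = w' m) -> pre w n = pre w' n.
Proof.
by elim: n => //= n IHn eq_w; rewrite eq_w // IHn // => m /leqW/eq_w.
Qed.

Definition no_dead_end T := forall h, T h -> exists v, T (v :: h).

Definition valid b T s := forall h, T h -> turn h = b -> T (s h :: h).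

Definition plays b T p s w := pre w (size p) = p /\
  forall n, size p <= n -> T (pre w n) /\ (turn (pre w n) = b -> w n = s (pre w n)).

Definition win b T p (O : word V -> Prop) :=
  exists2 s, valid b T s & forall w, plays b T p s w -> O w.

(** A quasi-strategy of the opponent [false]: only her moves are cut down, while [true] keeps every
    move of [T]. *)
Definition subgame T' T := (forall h, T' h -> T h) /\
  forall h, T' h ->
    if turn h then forall v, T (v :: h) -> T' (v :: h) else exists v, T' (v :: h).

Lemma subgame_no_dead_end T' T : subgame T' T -> no_dead_end T -> no_dead_end T'.
Proof.
move=> [sT cl] nd h Th; have := cl h Th; case: (turn h) => // all.
by have [v /all] := nd h (sT h Th); exists v.
Qed.

Lemma subgame_trans T1 T2 T3 : subgame T1 T2 -> subgame T2 T3 -> subgame T1 T3.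
Proof.
move=> [s1 c1] [s2 c2]; split=> [h /s1/s2//|h Th].
have := c1 h Th; have := c2 h (s1 h Th); case: (turn h) => // c2h c1h v.
by move=> /c2h/c1h.
Qed.

Lemma default_strategy b T p : no_dead_end T -> T p -> exists s, valid b T s.
Proof.
move=> nd Tp; have [d _] := nd p Tp.
suff /choice[s Hs] : forall h, exists v, T h -> T (v :: h) by exists s => h /Hs.
by move=> h; case: (pselect (T h)) => [/nd[v]|]; [exists v|exists d].
Qed.

(** One strategy per position is fixed in advance, so that a play can switch to the strategy of any
    position it reaches. *)
Lemma optimal_strategies b T p (O : seq V -> word V -> Prop) : no_dead_end T -> T p ->
  exists S : seq V -> strategy V, forall q, valid b T (S q) /\
    (win b T q (O q) -> forall w, plays b T q (S q) w -> O q w).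
Proof.
move=> nd Tp; have [s0 s0P] := default_strategy b nd Tp.
suff /choice[S HS] : forall q, exists s, valid b T s /\
    (win b T q (O q) -> forall w, plays b T q s w -> O q w) by exists S.
move=> q; case: (pselect (win b T q (O q))) => [[s sv sw]|nw]; first by exists s.
by exists s0; split.
Qed.

(** The earliest prefix of the history in [Q], as the older part is searched first. It is the memory
    of strategies that switch once, and [last_hit] that of strategies that restart. *)
Fixpoint first_hit (Q : pred (seq V)) x : option (seq V) :=
  if x is v :: h then
    if first_hit Q h is Some y then Some y else if Q x then Some x else None
  else if Q [::] then Some [::] else None.

Lemma first_hit_pre (Q : pred (seq V)) w n m :
  Q (pre w n) -> (forall k, k < n -> ~~ Q (pre w k)) -> n <= m ->
  first_hit Q (pre w m) = Some (pre w n).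
Proof.
move=> Qn Qk; have none k : k < n -> first_hit Q (pre w k) = None.
  elim: k => [|k IHk] ltk /=; first by rewrite (negPf (Qk _ ltk)).
  by rewrite IHk ?(ltnW ltk) // (negPf (Qk _ ltk)).
elim: m => [|m IHm]; first by rewrite leqn0 => /eqP n0; move: Qn; rewrite n0 /= => ->.
rewrite leq_eqVlt => /orP[/eqP nm|]; last by rewrite ltnS => /IHm /= ->.
by rewrite nm /= none ?nm // -/(pre w m.+1) -nm Qn.
Qed.

Lemma first_hit_none (Q : pred (seq V)) w n :
  (forall k, k <= n -> ~~ Q (pre w k)) -> first_hit Q (pre w n) = None.
Proof.
elim: n => [|n IHn] Qk /=; first by rewrite (negPf (Qk 0 _)).
by rewrite IHn ?(negPf (Qk n.+1 _)) // => k /leqW /Qk.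
Qed.

Lemma first_hitP (Q : pred (seq V)) x y : first_hit Q x = Some y -> Q y.
Proof.
elim: x => [|v h IHh] /=; first by case: ifP => // Q0 [<-].
by case: first_hit IHh => [z IHz /IHz //|_]; case: ifP => // Qx [<-].
Qed.

Lemma first_hit_size (Q : pred (seq V)) x y : first_hit Q x = Some y -> size y <= size x.
Proof.
elim: x => [|v h IHh] /=; first by case: ifP => // Q0 [<-].
by case: first_hit IHh => [z IHz /IHz/leqW //|_]; case: ifP => // Qx [<-].
Qed.

Fixpoint last_hit (Q : pred (seq V)) x : seq V :=
  if Q x then x else if x is v :: h then last_hit Q h else [::].

Lemma last_hit_pre (Q : pred (seq V)) w n m : Q (pre w n) -> n <= m ->
  (forall k, n < k -> k <= m -> ~~ Q (pre w k)) -> last_hit Q (pre w m) = pre w n.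
Proof.
move=> Qn; elim: m => [|m IHm].
  by rewrite leqn0 => /eqP n0 _; move: Qn; rewrite n0 /= => ->.
rewrite leq_eqVlt => /orP[/eqP nm _|ltnm Qk].
  by move: Qn; rewrite nm /= => ->.
rewrite /= (negPf (Qk m.+1 ltnm (leqnn _))) IHm // => k ltk lek.
exact: Qk (leqW lek).
Qed.

Lemma win_step b T h O : no_dead_end T -> T h ->
  (if turn h == b then exists2 v, T (v :: h) & win b T (v :: h) O
   else forall v, T (v :: h) -> win b T (v :: h) O) -> win b T h O.
Proof.
move=> nd Th; have [S HS] := optimal_strategies b (fun=> O) nd Th.
have next w : pre w (size h) = h -> pre w (size h).+1 = w (size h) :: h by move=> /= ->.
have [turnh [v Tv winv]|_ /= winv] := eqVneq (turn h) b.
  exists (fun x => if x == h then v else S (v :: h) x) => [x Tx tx|w [wh wP]].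
    by have [->|_] := eqVneq x h; [|exact: (HS _).1].
  refine ((HS (v :: h)).2 winv w _); have := wP _ (leqnn _); rewrite wh eqxx => -[_ /(_ turnh) ev].
  split=> [|n ltn]; first by rewrite [LHS]next // ev.
  have [Tn wn] := wP _ (ltnW ltn); split=> // /wn; move: ltn.
  by case: eqP => [<-|//]; rewrite /= size_pre ltnn.
(* [c x] recovers the position just after the opponent's move at [h], whose winning strategy is then
   kept. *)
pose c x := odflt x (first_hit (fun y => size y == (size h).+1) x).
exists (fun x => S (c x) x) => [x|w [wh wP]]; first exact: (HS _).1.
have Tv : T (w (size h) :: h) by rewrite -next //; exact: (wP _ (leqnSn _)).1.
refine ((HS (w (size h) :: h)).2 (winv _ Tv) w _).
split=> [|n ltn]; first by rewrite [LHS]next.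
have [Tn] := wP _ (ltnW ltn); rewrite /c (first_hit_pre (n := (size h).+1)) //=.
- by rewrite wh.
- by rewrite size_pre.
- by move=> k ltk; rewrite size_pre neq_ltn ltk.
Qed.

Lemma winW b T p (O O' : word V -> Prop) :
  (forall w, O w -> O' w) -> win b T p O -> win b T p O'.
Proof. by move=> OO' [s sv sw]; exists s => // w /sw/OO'. Qed.

(** * Restricting the opponent so as to rule out one Buchi condition *)

Section Restriction.
Variables (T : seq V -> Prop) (W : seq V -> Prop) (A : word V -> Prop).
Hypothesis nd : no_dead_end T.
Hypothesis W_A : forall w, infinitely_often (fun n => W (pre w n)) -> A w.

(** What Davis's argument asks of the opponent: a restriction that rules out one Buchi condition at
    no cost, [true] still being unable to force [A]. *)
Definition good_subgame y T' :=
  [/\ subgame T' T, T' y,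
      (forall w, pre w (size y) = y -> (forall n, size y <= n -> T' (pre w n)) ->
        ~ infinitely_often (fun n => W (pre w n)))
    & ~ win true T' y A].

Definition good y := exists T', good_subgame y T'.

Definition bad y := [/\ W y, T y & ~ good y].

Definition hit_bad m w := A w \/ exists2 n, m <= n & bad (pre w n).

Lemma hit_badW m n w : m <= n -> hit_bad n w -> hit_bad m w.
Proof.
move=> le_mn [|[k le_nk bk]]; first by left.
by right; exists k => //; apply: leq_trans le_nk.
Qed.

(* Otherwise the opponent stays among the positions from which hitting a bad position
   cannot be forced, and enters a good subgame at the first visit to W. *)
Lemma not_good_win q : T q -> ~ good q -> win true T q (hit_bad (size q).+1).
Proof.
move=> Tq ngood; apply: contrapT => nwin; apply: ngood.
(* Bad positions count from [x] on, but only strictly after [q], which may itself be bad. *)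
pose X x := win true T x (hit_bad (maxn (size x) (size q).+1)).
have Xq : ~ X q by rewrite /X (maxn_idPr _).
have Xstep h : T h -> ~ X h -> if turn h then forall v, T (v :: h) -> ~ X (v :: h)
    else exists2 v, T (v :: h) & ~ X (v :: h).
  move=> Th nX.
  have Xw v : X (v :: h) -> win true T (v :: h) (hit_bad (maxn (size h) (size q).+1)).
    apply: winW => w; apply: hit_badW; rewrite geq_max leq_maxr andbT.
    by rewrite leq_max /= leqnSn.
  case E: (turn h).
    by move=> v Tv /Xw Xv; apply: nX; apply: win_step; rewrite ?E //; exists v.
  apply: contrapT => H; apply: nX; apply: win_step; rewrite ?E //= => v Tv.
  by apply: Xw; apply: contrapT => nXv; apply: H; exists v.
have [TT TTP] : exists TT, forall y, good y -> good_subgame y (TT y).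
  suff /choice[TT] : forall y, exists T', good y -> good_subgame y T' by exists TT.
  by move=> y; case: (pselect (good y)) => [[T' ?]|?]; [exists T'|exists T].
pose Q x := `[< W x >] && (size q < size x).
have Qgood y : T y -> ~ X y -> Q y -> good y.
  move=> Ty nXy /andP[/asboolP Wy lty]; apply: contrapT => ng; apply: nXy.
  have [s sv] := default_strategy true nd Ty.
  exists s => // w [wy _]; right; exists (size y); first by rewrite (maxn_idPl lty).
  by rewrite wy.
(* Up to the first visit to [W] after [q] the opponent stays outside [X]; from that visit on she
   keeps to the good subgame chosen there. *)
pose U x := if first_hit Q x is Some y then [/\ T y, ~ X y & TT y x] else T x /\ ~ X x.
have UT x : U x -> T x.
  rewrite /U; case E: first_hit => [y|] [] // Ty nXy.
  have [[sT _] _ _ _] := TTP _ (Qgood y Ty nXy (first_hitP E)); exact: sT.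
have Unext h v : U h -> first_hit Q h = None -> T (v :: h) -> ~ X (v :: h) -> U (v :: h).
  rewrite /U /= => + E; rewrite E => -[Th nXh] Tv nXv.
  case: ifP => // Qv; split=> //.
  by have [] := TTP _ (Qgood _ Tv nXv Qv).
have subU : subgame U T.
  split=> // h Uh; case E: (first_hit Q h) => [y|]; last first.
    have := Uh; rewrite {1}/U E => -[Th /(Xstep h Th)]; case: (turn h) => [nX v Tv|[v Tv nXv]].
      by apply: Unext (nX v Tv).
    by exists v; apply: Unext.
  have := Uh; rewrite {1}/U E => -[Ty nXy TTh].
  have [[_ cl] _ _ _] := TTP _ (Qgood y Ty nXy (first_hitP E)); have := cl h TTh.
  by case: (turn h) => [all v /all|[v]] TTv; [|exists v]; rewrite /U /= E.
have ltQ w k : k <= size q -> ~~ Q (pre w k).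
  by move=> ltk; rewrite /Q size_pre ltnNge ltk andbF.
have firstW w : (exists2 n, size q < n & W (pre w n)) ->
    exists n, [/\ Q (pre w n), size q < n, forall k, k < n -> ~~ Q (pre w k)
                & forall m, n <= m -> first_hit Q (pre w m) = Some (pre w n)].
  move=> [k ltk Wk]; have exQ : exists n, Q (pre w n).
    by exists k; rewrite /Q size_pre ltk andbT; apply/asboolP.
  have [n Qn min_n] := ex_least exQ; exists n; split=> //.
  - by have := Qn; rewrite /Q size_pre => /andP[].
  - by move=> i /min_n/negP.
  by move=> m; apply: first_hit_pre => // i /min_n/negP.
exists U; split=> //.
- case E: (first_hit Q q) => [y|]; last by rewrite /U E.
  have /andP[_] := first_hitP E; have := first_hit_size E.
  by rewrite ltnNge => ->.
- move=> w wq wU infW.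
  have [k ltk Wk] := infW (size q).+1.
  have [|n [Qn ltn _ hit]] := firstW w; first by exists k.
  have Un m : n <= m -> [/\ T (pre w n), ~ X (pre w n) & TT (pre w n) (pre w m)].
    move=> lem; have := wU m; rewrite /U hit //; apply.
    exact: leq_trans (ltnW ltn) lem.
  have [Tn nXn _] := Un _ (leqnn _).
  have [_ _ fin _] := TTP _ (Qgood _ Tn nXn Qn); apply: (fin w) infW.
    by rewrite size_pre.
  by move=> m; rewrite size_pre => /Un[].
(* A strategy [s] winning [A] in [U] would put [q] in [X]: [s'] follows [s] and switches for good
   once the play enters [X]. The branch [S q x] only keeps [s'] valid outside [U]. *)
move=> [s sv sA].
have [S HS] := optimal_strategies true (fun x => hit_bad (maxn (size x) (size q).+1)) nd Tq.
pose QX x := `[< X x >] && (size q <= size x).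
pose s' x := if first_hit QX x is Some y then S y x else
  if `[< U x >] then s x else S q x.
have s'v : valid true T s'.
  move=> h Th th; rewrite /s'; case: first_hit => [y|]; first exact: (HS _).1.
  case: asboolP => [Uh|_]; first exact/UT/sv.
  exact: (HS _).1.
apply: Xq; exists s' => // w [wq wP]; rewrite (maxn_idPr (leqnSn _)).
have [[n [len Xn]]|noX] := pselect (exists n, size q <= n /\ X (pre w n)).
  have exQ : exists n, QX (pre w n).
    by exists n; rewrite /QX size_pre len andbT; apply/asboolP.
  have [{len Xn}n /andP[/asboolP Xn +] min_n] := ex_least exQ.
  rewrite size_pre => len.
  have := (HS (pre w n)).2 Xn w; rewrite size_pre => H; apply: hit_badW (H _).
    exact: leq_maxr.
  split; rewrite size_pre // => m lem; have [Tm sm] := wP m (leq_trans len lem); split=> //.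
  move=> /sm; rewrite /s' (first_hit_pre (n := n)) //.
    by rewrite /QX size_pre len andbT; apply/asboolP.
  by move=> k /min_n/negP.
have nXw n : size q <= n -> ~ X (pre w n) by move=> len Xn; apply: noX; exists n.
have hitX n : first_hit QX (pre w n) = None.
  apply: first_hit_none => k _; apply/negP; rewrite /QX size_pre => /andP[/asboolP Xk lek].
  exact: nXw lek Xk.
(* At a first visit [y] to [W], [s] would go on to win [A] inside the good subgame [TT y], which
   excludes this. *)
have noW : ~ exists2 n, size q < n & W (pre w n).
  move=> /firstW[n [Qn ltn min_n hit]].
  have [Tn _] := wP n (ltnW ltn); have nXn := nXw n (ltnW ltn).
  have gn := Qgood _ Tn nXn Qn; have [sub TTn _] := TTP _ gn; apply.
  have [s0 s0v] := default_strategy true (subgame_no_dead_end sub nd) TTn.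
  pose y := pre w n.
  exists (fun x => if first_hit Q x == Some y then s x else s0 x) => [x TTx tx|w2 [yw2 w2P]].
    case: eqP => [hx|_]; last exact: s0v.
    have Ux : U x by rewrite /U hx.
    by have := sv x Ux tx; rewrite /U /= hx => -[].
  rewrite size_pre in yw2 w2P; have agree k : k <= n -> pre w2 k = pre w k.
    exact: pre_agree yw2.
  have hit2 k : n <= k -> first_hit Q (pre w2 k) = Some y.
    move=> lek; rewrite (first_hit_pre (n := n)) // ?yw2 // => i lti.
    rewrite agree ?(ltnW lti) //; exact: min_n.
  apply: sA; split=> [|k lek]; first by rewrite agree // ltnW.
  have [ltkn|lenk] := ltnP k n; last first.
    have [TTk sk] := w2P k lenk; rewrite hit2 // eqxx in sk.
    by split=> //; rewrite /U hit2.
  have [] := agree k.+1 ltkn => ->; rewrite agree; last exact: ltnW.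
  have [Tk sk] := wP k lek.
  have Uk : U (pre w k).
    rewrite /U first_hit_none => [|i lei]; first by split=> //; apply: nXw.
    by apply: min_n; apply: leq_ltn_trans lei ltkn.
  by split=> // /sk; rewrite /s' hitX asboolT.
left; apply: sA; split=> // n len.
have [Tn sn] := wP n len.
have Un : U (pre w n).
  rewrite /U first_hit_none => [|k _]; first by split=> //; apply: nXw.
  by apply/negP; rewrite /Q size_pre => /andP[/asboolP Wk ltk]; apply: noW; exists k.
by split=> // /sn; rewrite /s' hitX asboolT.
Qed.
(* If p were not good, the strategy of [not_good_win], restarted at every bad
   position, would win: either it is restarted infinitely often, so that W is visited
   infinitely often, or the last restart already ensures A. *)
Lemma all_good p : T p -> ~ win true T p A -> good p.
Proof.
move=> Tp nwin; apply: contrapT => ngood; apply: nwin.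
have [S HS] := optimal_strategies true (fun q => hit_bad (size q).+1) nd Tp.
pose Q x := `[< bad x >] || (x == p).
exists (fun x => S (last_hit Q x) x) => [x|w [wp wP]]; first exact: (HS _).1.
have [infb|finb] := pselect (infinitely_often (fun n => bad (pre w n))).
  by apply: W_A => m; have [n lemn []] := infb m; exists n.
have [N noB] : exists N, forall n, N <= n -> ~ bad (pre w n).
  apply: contrapT => noN; apply: finb => m; apply: contrapT => nom.
  by apply: noN; exists m => n lemn bn; apply: nom; exists n.
have exQ : exists n, Q (pre w n) by exists (size p); rewrite /Q wp eqxx orbT.
have boundQ n : Q (pre w n) -> n <= maxn N (size p).
  rewrite leq_max => /orP[/asboolP bn|/eqP<-]; last by rewrite size_pre leqnn orbT.
  by have [//|/ltnW leNn] := leqP n N; case: (noB n leNn bn).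
case: (ex_maxnP exQ boundQ) => n Qn max_n.
have len : size p <= n by apply: max_n; rewrite /Q wp eqxx orbT.
have [Tn _] := wP n len.
have ng : ~ good (pre w n) by case/orP: Qn => [/asboolP[]|/eqP->].
have := (HS (pre w n)).2 (not_good_win Tn ng) w; rewrite size_pre.
case=> [|//|[m ltnm bm]].
  split; rewrite size_pre // => m lenm; have [Tm sm] := wP m (leq_trans len lenm).
  split=> // /sm; rewrite (last_hit_pre Qn lenm) // => k ltnk _.
  by apply: contraL ltnk => /max_n; rewrite leqNgt.
have : Q (pre w m) by apply/orP; left; apply/asboolP.
by move/max_n; rewrite leqNgt ltnm.
Qed.

End Restriction.

Definition sigma03 (A : word V -> Prop) := exists W : nat -> seq V -> Prop,
  forall w, A w <-> exists k, infinitely_often (fun n => W k (pre w n)).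

(** As long as [true] does not win, [all_good] lets the opponent restrict herself further and keep
    it so; she rules out the sets [W k] one after the other along the play. *)
Theorem sigma03_determinacy T p A : no_dead_end T -> T p -> sigma03 A ->
  win true T p A \/ win false T p (fun w => ~ A w).
Proof.
move=> nd Tp [W AW]; have [|nwin] := pselect (win true T p A); [by left|right].
have [F FP] : exists F : nat * (seq V -> Prop) * seq V -> seq V -> Prop,
    forall k U h, no_dead_end U -> U h -> ~ win true U h A ->
    good_subgame U (W k) A h (F (k, U, h)).
  suff /choice[F FP] : forall a : nat * (seq V -> Prop) * seq V, exists U',
      no_dead_end a.1.2 -> a.1.2 a.2 -> ~ win true a.1.2 a.2 A ->
      good_subgame a.1.2 (W a.1.1) A a.2 U'.
    by exists F => k U h; apply: (FP (k, U, h)).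
  move=> [[k U] h] /=; apply: contrapT => noU'; apply: (noU'); exists U => ndU Uh nw.
  have [|U' U'P] := all_good ndU _ Uh nw (W := W k); last by case: noU'; exists U'.
  by move=> w infW; apply/AW; exists k.
(* mem h is the subgame to which the opponent restricts herself at h. It shrinks along
   each play, and the k-th restriction below p excludes infinitely many visits to W k. *)
pose fix mem h := if h is v :: h' then
    if size h <= size p then F (0, T, h) else F (size h - size p, mem h', h)
  else F (0, T, h).
(* The opponent moves so that [true] still does not win the current subgame; any move of [T] is the
   default. *)
have [s sP] : exists s : strategy V, forall h, T h -> T (s h :: h) /\
    ((exists v, [/\ T (v :: h), mem h (v :: h) & ~ win true (mem h) (v :: h) A]) ->
     mem h (s h :: h) /\ ~ win true (mem h) (s h :: h) A).
  suff /choice[s sP] : forall h, exists v, T h -> T (v :: h) /\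
    ((exists v, [/\ T (v :: h), mem h (v :: h) & ~ win true (mem h) (v :: h) A]) ->
     mem h (v :: h) /\ ~ win true (mem h) (v :: h) A) by exists s.
  move=> h; have [[v [Tv mv nv]]|nov] :=
    pselect (exists v, [/\ T (v :: h), mem h (v :: h) & ~ win true (mem h) (v :: h) A]).
    by exists v.
  have [Th|nTh] := pselect (T h); last by have [d _] := nd p Tp; exists d.
  by have [v Tv] := nd h Th; exists v.
exists s => [h Th _|w [wp wP]]; first exact: (sP h Th).1.
have memE n : size p <= n ->
    mem (pre w n.+1) = F (n.+1 - size p, mem (pre w n), pre w n.+1).
  by move=> len; rewrite /= size_pre leqNgt ltnS len.
have mem0 : mem (pre w (size p)) = F (0, T, p).
  by rewrite wp /mem; case: (p) => // v h; rewrite leqnn.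
clearbody mem.
pose inv n := [/\ subgame (mem (pre w n)) T, mem (pre w n) (pre w n),
  ~ win true (mem (pre w n)) (pre w n) A &
  forall w', pre w' n = pre w n -> (forall m, n <= m -> mem (pre w n) (pre w' m)) ->
    ~ infinitely_often (fun m => W (n - size p) (pre w' m))].
have step n : size p <= n -> inv n ->
    inv n.+1 /\ forall x, mem (pre w n.+1) x -> mem (pre w n) x.
  move=> len [sub mn nwn _]; have [Tn sn] := wP n len.
  have ndn := subgame_no_dead_end sub nd.
  have [mS nwS] : mem (pre w n) (pre w n.+1) /\ ~ win true (mem (pre w n)) (pre w n.+1) A.
    have cl := sub.2 _ mn; move: cl sn; case E: (turn (pre w n)) => cl sn.
      have [Tn1 _] := wP n.+1 (leqW len); split=> [|win1]; first exact: cl.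
      by apply: nwn; apply: win_step => //; rewrite E /=; exists (w n) => //; apply: cl.
    rewrite /= sn //; apply: (sP _ Tn).2; apply: contrapT => nov; apply: nwn.
    apply: win_step => //; rewrite E /= => v mv; apply: contrapT => nwv.
    by apply: nov; exists v; split=> //; apply: sub.1.
  have := FP (n.+1 - size p) _ _ ndn mS nwS; rewrite -(memE _ len).
  move=> [subS mS' finS nwS']; split; last exact: subS.1.
  by split=> //; [exact: subgame_trans subS sub|move: finS; rewrite size_pre].
have inv0 : inv (size p).
  have [sub0 m0 fin0 nw0] := FP 0 _ _ nd Tp nwin.
  rewrite /inv mem0 subnn wp; split=> //.
have invP n : size p <= n -> inv n.
  elim: n => [|n IHn]; first by rewrite leqn0 => /eqP p0; move: inv0; rewrite p0.
  rewrite leq_eqVlt => /orP[/eqP<-//|]; rewrite ltnS => len.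
  by have [] := step n len (IHn len).
move/AW=> [k infW].
have lek : size p <= size p + k by rewrite leq_addr.
have [_ _ _ fin] := invP _ lek; apply: (fin w) => // [m lem|]; last by rewrite addKn.
have {}lek := leq_trans lek lem.
(* The subgames shrink, so membership in the one at [m] is carried back to the one at [size p + k];
   the member is generalized to [x] for the induction. *)
have [_ mm _ _] := invP m lek; move: mm; move: {2 3}(pre w m) => x.
elim: m {lek} lem => [|m IHm] lem.
  by move: lem; rewrite leqn0 => /eqP->.
move: lem; rewrite leq_eqVlt => /orP[/eqP->//|]; rewrite ltnS => lem mx.
apply: IHm => //; have lem' := leq_trans (leq_addr k _) lem.
by apply: (step m lem' (invP m lem')).2.
Qed.

End Games.

(** * Omega-regular sets are countable unions of Buchi conditions on prefixes *)

Lemma infinite_pigeonhole (C : finType) (J : nat -> Prop) (f : nat -> C) :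
  infinitely_often J -> exists c, infinitely_often (fun n => J n /\ f n = c).
Proof.
move=> infJ; apply: contrapT => noc.
have /choice[N NP] : forall c, exists N, forall n, N <= n -> J n -> f n <> c.
  move=> c; apply: contrapT => noN; apply: noc; exists c => m; apply: contrapT => nom.
  by apply: noN; exists m => n lemn Jn fn; apply: nom; exists n.
have [n len Jn] := infJ (\max_c N c).
by apply: (NP (f n) n _ Jn erefl); apply: leq_trans (leq_bigmax _) len.
Qed.

(* More than #|C| positions cannot be pairwise non-merging: otherwise the values
   phi n k, for a common large k, would be pairwise distinct. *)
Lemma infinite_merging_class (C : finType) (phi : nat -> nat -> C) :
  exists n, infinitely_often (fun m => exists k, [/\ n <= k, m <= k & phi n k = phi m k]).
Proof.
apply: contrapT => nocls.
have /choice[N NP] : forall n, exists N, forall m k, N <= m -> n <= k -> m <= k ->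
    phi n k <> phi m k.
  move=> n; apply: contrapT => noN; apply: nocls; exists n => M.
  apply: contrapT => noM; apply: noN; exists M => m k leMm lenk lemk eq_phi.
  by apply: noM; exists m => //; exists k.
pose a i := iter i (fun x => maxn x (N x)) 0.
have a_le i j : i <= j -> a i <= a j.
  move=> /subnK <-; elim: (j - i) => // d IHd.
  by apply: leq_trans IHd _; rewrite addSn /= leq_maxl.
have N_le i j : i < j -> N (a i) <= a j.
  by move=> /a_le; apply: leq_trans; rewrite /= leq_maxr.
pose K := a #|C|.
have inj : injective (fun i : 'I_#|C|.+1 => phi (a i) K).
  have aux (i j : 'I_#|C|.+1) : i < j -> phi (a i) K <> phi (a j) K.
    move=> ltij; apply: NP; first exact: N_le.
      exact: (a_le i _ (ltn_ord i)).
    exact: (a_le j _ (ltn_ord j)).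
  move=> i j /= eq_phi; apply/val_inj; case: (ltngtP i j) => // /aux; first by rewrite eq_phi.
  by rewrite eq_phi.
by have := leq_card _ inj; rewrite card_ord ltnn.
Qed.

(** * Transition profiles of a Buchi automaton and Ramsey factorizations *)

Section Profiles.
Variables (V : finType) (B : buchi V).
Local Notation Q := (bstate B).
Implicit Types (w : word V) (r : nat -> Q) (e : {set Q * bool * Q}).

Definition run_on r w i j := forall x, i <= x -> x < j -> btrans (r x) (w x) (r x.+1).

(** With [b] false nothing is claimed about acceptance. The window [i < x <= j] is half-open, so
    consecutive segments share no position. *)
Definition profile_run w i j p (b : bool) q r :=
  [/\ r i = p, r j = q, run_on r w i j & b -> exists2 x, i < x <= j & bacc (r x)].

(** The image of the factor of [w] from [i] to [j] in the finite transition semigroup of the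
    automaton, [comp_profile] being the product. *)
Definition segment_profile w i j : {set Q * bool * Q} :=
  [set t : Q * bool * Q | `[< exists r, profile_run w i j t.1.1 t.1.2 t.2 r >]].

Lemma segment_profileP w i j p b q :
  reflect (exists r, profile_run w i j p b q r) ((p, b, q) \in segment_profile w i j).
Proof. by rewrite inE; apply: asboolP. Qed.

Definition comp_profile e e' : {set Q * bool * Q} :=
  [set t : Q * bool * Q | `[< exists s b b', [/\ (t.1.1, b, s) \in e, (s, b', t.2) \in e'
                                & t.1.2 -> b || b'] >]].

Lemma segment_profile_comp w i j k : i <= j -> j <= k ->
  segment_profile w i k = comp_profile (segment_profile w i j) (segment_profile w j k).
Proof.
move=> leij lejk; apply/setP => -[[p b] q]; apply/segment_profileP/idP => [|].
  move=> [r [ri rk run acc]]; rewrite inE; apply/asboolP => /=.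
  pose b1 := `[< exists2 x, i < x <= j & bacc (r x) >].
  pose b2 := `[< exists2 x, j < x <= k & bacc (r x) >].
  exists (r j), b1, b2; split.
  - apply/segment_profileP; exists r; split=> // [x leix ltxj|/asboolP//].
    by apply: run => //; apply: leq_trans lejk.
  - apply/segment_profileP; exists r; split=> // [x lejx ltxk|/asboolP//].
    by apply: run => //; apply: leq_trans lejx.
  move=> /acc[x /andP[ltix lexk] accx]; apply/orP.
  by have [lexj|ltjx] := leqP x j; [left|right]; apply/asboolP; exists x; rewrite ?ltix ?ltjx.
rewrite inE => /asboolP[s [b1 [b2 [/= /segment_profileP[r1 [r1i r1j run1 acc1]]
  /segment_profileP[r2 [r2j r2k run2 acc2]] b12]]]].
pose r x := if x <= j then r1 x else r2 x.
have r1E x : x <= j -> r x = r1 x by rewrite /r => ->.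
have r2E x : j <= x -> r x = r2 x.
  by rewrite /r; case: ltngtP => // <-; rewrite r1j r2j.
exists r; split; [by rewrite r1E|by rewrite r2E| |].
  move=> x leix ltxk; have [ltxj|lejx] := ltnP x j.
    by rewrite !r1E ?(ltnW ltxj) //; apply: run1.
  by rewrite !r2E ?(leqW lejx) //; apply: run2.
move=> /b12/orP[/acc1|/acc2] [x /andP[ltx lex] accx]; exists x.
- by rewrite ltx (leq_trans lex lejk).
- by rewrite r1E.
- by rewrite lex (leq_ltn_trans leij ltx).
- by rewrite r2E // ltnW.
Qed.

Lemma run_on_ext r w w' i j : (forall x, x < j -> w x = w' x) ->
  run_on r w i j -> run_on r w' i j.
Proof. by move=> eqw run x leix ltxj; rewrite -eqw //; apply: run. Qed.

Lemma segment_profile_ext w w' i j : (forall x, x < j -> w x = w' x) ->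
  segment_profile w i j = segment_profile w' i j.
Proof.
move=> eqw; apply/setP => -[[p b] q].
apply/segment_profileP/segment_profileP => -[r [ri rj run acc]]; exists r; split=> //;
  apply: run_on_ext run => // x ltxj; by rewrite eqw.
Qed.

(** For an idempotent [e], an infinite sequence of factors of profile [e] then carries an accepting
    run from [p], which loops at [q]. *)
Definition linked p q e := [/\ comp_profile e e = e, (q, true, q) \in e
  & exists b, (p, b, q) \in e].

(* Minimality of m makes it a function of j, so that infinitely many blocks have
   infinitely many distinct j; this turns the omega-power of e into a condition on
   the set of prefixes. *)
Definition block w n p e m :=
  (exists r, [/\ binit (r 0), r n = p & run_on r w 0 n]) /\
  exists j, [/\ n < j < m, segment_profile w n j = e, segment_profile w j m = e
              & forall m', j < m' < m -> segment_profile w j m' <> e].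

Lemma block_ext w w' n p e m : (forall x, x < m -> w x = w' x) ->
  block w n p e m -> block w' n p e m.
Proof.
move=> eqw [[r [r0 rn run]] [j [/andP[ltnj ltjm] ej em min_m]]].
have sub k x : k <= m -> x < k -> w x = w' x.
  by move=> lek ltx; apply/eqw/(leq_trans ltx).
have lenm := ltnW (ltn_trans ltnj ltjm).
split; first by exists r; split=> //; apply: run_on_ext run => x; apply: sub.
exists j; rewrite ltnj ltjm; split=> //.
- by rewrite -ej; apply/esym/segment_profile_ext => x; apply/sub/ltnW.
- by rewrite -em; apply/esym/segment_profile_ext.
move=> k ltk; rewrite -(segment_profile_ext (w := w)); first exact: min_m.
by move=> x; apply: sub; case/andP: ltk => _ /ltnW.
Qed.

(** Infinitely many [j] merge with one [n]; the pigeonhole principle fixes the profile [e] from [n]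
    to [j] and the state [q] of the run at [j]. *)
Lemma accepts_blocks w : buchi_accepts B w ->
  exists n p q e, linked p q e /\ infinitely_often (block w n p e).
Proof.
move=> [r [r0 run acc]]; pose phi := segment_profile w.
have [n cls] := infinite_merging_class phi.
pose J m := n < m /\ exists k, [/\ n <= k, m <= k & phi n k = phi m k].
have infJ : infinitely_often J.
  move=> m; have [k] := cls (maxn m n.+1); rewrite geq_max => /andP[lemk ltnk] mk.
  by exists k.
have [[e q] infC] := infinite_pigeonhole (fun j => (phi n j, r j)) infJ.
(* Profiles from [n] and from [j] that agree at [k] agree at every later [m], so a late [m] of the
   class has profile [e] from both. *)
have late j N : n < j -> (exists k, [/\ n <= k, j <= k & phi n k = phi j k]) ->
    exists m, [/\ N <= m, j < m, phi n m = e, r m = q & phi j m = e].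
  move=> ltnj [k [lenk lejk eqk]].
  have [m] := infC (maxn N (maxn j.+1 k)); rewrite !geq_max => /and3P[leN ltj lek].
  move=> [_ [em rm]]; exists m; split=> //; rewrite -em /phi.
  by rewrite (segment_profile_comp w lejk lek) -/(phi j k) -eqk -segment_profile_comp.
exists n, (r n), q, e; split.
  have [j _ [[ltnj merge] [ej rj]]] := infC 0.
  (* Taking [m] past an accepting visit [x] makes the loop at [q] accepting. *)
  have [x lejx accx] := acc j.+1.
  have [m [lexm ltjm em rm ejm]] := late j x ltnj merge.
  split.
  - by rewrite -{1}ej -{1}ejm -segment_profile_comp // ltnW.
  - rewrite -ejm; apply/segment_profileP; exists r; split=> // _.
    by exists x; rewrite // lejx lexm.
  - by exists false; rewrite -ej; apply/segment_profileP; exists r; split.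
move=> N; have [j leNj [[ltnj merge] [ej rj]]] := infC N.
have exm : exists m, j < m /\ phi j m = e.
  by have [m [_ ltjm _ _ ejm]] := late j 0 ltnj merge; exists m.
have [m [ltjm ejm] min_m] := ex_least exm.
exists m; first exact: leq_trans leNj (ltnW ltjm).
split; first by exists r; split.
exists j; rewrite ltnj ltjm; split=> // k /andP[ltjk ltkm] ejk.
by apply: (min_m k ltkm).
Qed.

(* If a block starts at j and ends at m, and the next one starts at j' >= m, then
   phi n j' = e forces phi j j' = e, since both equal e composed with phi m j'. *)
Lemma blocks_accepts w n p q e : linked p q e -> infinitely_often (block w n p e) ->
  buchi_accepts B w.
Proof.
move=> [ee qq [b pq]] inf; pose phi := segment_profile w.
pose P j m := [/\ n < j < m, phi n j = e, phi j m = e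
              & forall m', j < m' < m -> phi j m' <> e].
have P_inj j m m' : P j m -> P j m' -> m = m'.
  move=> [/andP[_ ltjm] _ ejm min_m] [/andP[_ ltjm'] _ ejm' min_m'].
  case: (ltngtP m m') => // lt; first by case: (min_m' m); rewrite ?ltjm.
  by case: (min_m m'); rewrite ?ltjm'.
(* Since [j] determines [m], starts below [N] give boundedly many ends; as the ends are unbounded,
   so are the starts. *)
have bound N : exists M, forall j m, j < N -> P j m -> m < M.
  elim: N => [|N [M MP]]; first by exists 0.
  have [[m0 Pm0]|no] := pselect (exists m, P N m).
    exists (maxn M m0.+1) => j m; rewrite ltnS leq_eqVlt leq_max => /orP[/eqP->|ltj] Pm.
      by rewrite (P_inj _ _ _ Pm Pm0) ltnSn orbT.
    by rewrite (MP j m).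
  exists M => j m; rewrite ltnS leq_eqVlt => /orP[/eqP->|ltj] Pm; last exact: MP Pm.
  by case: no; exists m.
have next N : exists j, N <= j /\ exists m, P j m.
  have [M MP] := bound N; have [m leM [_ [j Pj]]] := inf M.
  exists j; split; last by exists m.
  by rewrite leqNgt; apply/negP => ltj; have := MP j m ltj Pj; rewrite ltnNge leM.
have /choice[g gP] : forall j, exists j', (exists m, P j m) ->
    [/\ j < j', exists m, P j' m & phi j j' = e].
  move=> j; have [[m Pm]|no] := pselect (exists m, P j m); last by exists 0.
  have [j' [lemj' Pj']] := next m; exists j' => _.
  have [/andP[ltnj ltjm] ej ejm _] := Pm; split=> //; first exact: leq_trans lemj'.
  have [m' [_ ej' _ _]] := Pj'.
  have [lenj lejm] := (ltnW ltnj, ltnW ltjm).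
  rewrite /phi (segment_profile_comp w lejm lemj') -/(phi j m) ejm -{1}ee -{1}ej -{1}ejm.
  rewrite /phi -segment_profile_comp // -segment_profile_comp //; exact: leq_trans lejm.
have [j0 [_ Pj0]] := next 0; pose a i := iter i g j0.
have aP i : exists m, P (a i) m by elim: i => // i /gP[].
have a_lt i : a i < a i.+1 by have [] := gP _ (aP i).
have a_e i : phi (a i) (a i.+1) = e by have [] := gP _ (aP i).
(* The initial run reaches [p] at [n], and the profile [e] leads it from there to [q] at [a 0]. *)
have [r0 [r0i r0p run0]] : exists r, [/\ binit (r 0), r (a 0) = q & run_on r w 0 (a 0)].
  have [_ _ [[r1 [r1i r1n run1]] _]] := inf 0.
  have [m [/andP[ltn _] ej _ _]] := Pj0.
  have : (p, b, q) \in phi n j0 by rewrite ej.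
  move=> /segment_profileP[r2 [r2n r2j run2 _]].
  exists (fun x => if x <= n then r1 x else r2 x); split=> /=; [by []|by rewrite leqNgt ltn|].
  move=> x _ ltxj; case: (ltngtP x n) => [ltxn|ltnx|xn].
  - exact: run1.
  - by apply: run2 => //; apply: ltnW.
  by rewrite xn r1n -r2n; apply: run2; rewrite // -xn.
have /choice[R RP] : forall i, exists r, profile_run w (a i) (a i.+1) q true q r.
  by move=> i; apply/segment_profileP; rewrite -/phi a_e.
(* The pieces are glued into one run; k x counts the i with a i <= x. *)
pose fix k x := if x is y.+1 then if a (k y) <= x then (k y).+1 else k y
                else if a 0 <= 0 then 1 else 0.
pose piece i := if i is i'.+1 then R i' else r0.
have k_bounds x : (forall i, k x = i.+1 -> a i <= x) /\ x < a (k x).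
  elim: x => [|x [IH1 IH2]] /=.
    case: (leqP (a 0) 0) => a0; last by split.
    by split=> [i [<-]//|]; apply: leq_ltn_trans (a_lt 0).
  have [ax|ax] := leqP (a (k x)) x.+1.
    split=> [i [<-]//|]; have -> : x.+1 = a (k x) by apply/eqP; rewrite eqn_leq IH2.
    exact: a_lt.
  split=> [i ki|//]. exact: leqW (IH1 i ki).
have pieceE i : piece i (a i) = q by case: i => [|i] //=; have [] := RP i.
have pieceSE i : piece i.+1 (a i) = q by have [] := RP i.
pose r x := piece (k x) x.
have a_le i j : i <= j -> a i <= a j.
  by move=> /subnK <-; elim: (j - i) => // d IHd; apply: leq_trans IHd (ltnW (a_lt _)).
have a_lt' i j : i < j -> a i < a j by move=> /a_le; apply: leq_trans (a_lt i).
(* At a junction [a i] the run [r] already uses piece [i.+1]; both pieces have state [q] there. *)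
have rE i x : (if i is i'.+1 then a i' <= x else true) -> x <= a i -> r x = piece i x.
  move=> lex; rewrite leq_eqVlt => /orP[/eqP xE|ltx].
    rewrite /r; have [k1 k2] := k_bounds x.
    suff -> : k x = i.+1 by rewrite xE pieceSE pieceE.
    apply/eqP; rewrite eqn_leq ltnNge; apply/andP; split; last first.
      by apply/negP => /a_le; rewrite leqNgt -xE k2.
    case: (k x) k1 => // i' /(_ _ erefl) le.
    by rewrite ltnS leqNgt; apply/negP => /a_lt'; rewrite ltnNge -xE le.
  rewrite /r; suff -> : k x = i by [].
  have [k1 k2] := k_bounds x; apply/eqP; rewrite eqn_leq; apply/andP; split.
    case: (k x) k1 => // i' /(_ _ erefl) le; rewrite ltnNge; apply/negP => /a_le.
    by rewrite leqNgt (leq_ltn_trans le ltx).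
  case: i lex {ltx} => // i lex; rewrite ltnNge; apply/negP => /a_le.
  by rewrite leqNgt (leq_ltn_trans lex k2).
have le_a i : i <= a i by elim: i => // i IHi; apply: leq_ltn_trans (a_lt i).
exists r; split.
- by rewrite (rE 0).
- move=> x; have [k1 k2] := k_bounds x; case: (k x) k1 k2 => [|i] k1 k2.
    by rewrite !(rE 0) ?(ltnW k2) //; apply: run0.
  have lex := k1 i erefl; rewrite !(rE i.+1) ?(ltnW k2) ?(leqW lex) //=.
  by have [_ _ run _] := RP i; apply: run.
move=> m; have [_ _ _ /(_ isT) [x /andP[ltx lex] accx]] := RP m.
exists x; first exact: leq_trans (le_a m) (ltnW ltx).
by rewrite (rE m.+1) //= ltnW.
Qed.

End Profiles.

(** The parameters of a block form a countable type, coded by [pickle]. By [block_ext] a block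
    ending at [m] depends on the first [m] letters only, so any word extending [h] can witness
    it. *)
Theorem omega_regular_sigma03 (V : finType) (L : word V -> Prop) :
  omega_regular L -> sigma03 L.
Proof.
move=> [B BP].
pose idx := (nat * bstate B * bstate B * {set bstate B * bool * bstate B})%type.
exists (fun k h => exists (c : idx) w, [/\ unpickle k = Some c, pre w (size h) = h,
  linked c.1.1.2 c.1.2 c.2 & block w c.1.1.1 c.1.1.2 c.2 (size h)]) => w.
rewrite BP; split=> [/accepts_blocks[n [p [q [e [lnk inf]]]]]|[k inf]].
  exists (pickle ((n, p, q, e) : idx)) => m; have [i lemi bi] := inf m.
  by exists i => //; exists (n, p, q, e), w; rewrite pickleK size_pre.
have [_ _ [[[[n p] q] e] [_ [kE _ lnk _]]]] := inf 0.
apply: blocks_accepts lnk _ => m; have [i lemi [c [w' [kE' eqw _ bi]]]] := inf m.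
exists i => //; move: kE' eqw bi; rewrite kE size_pre => -[<-] /= eqw.
apply: block_ext => x ltx; have := pre_agree eqw ltx; by case.
Qed.

(** * Ranks, values and the equilibrium *)

Lemma sigma03_upper_set (V : finType) (R : word V -> word V -> Prop) x :
  omega_recognizable R -> sigma03 (R x).
Proof.
move=> [n [X [Y [reg RE]]]].
have /choice[W WP] : forall k, exists W : nat -> seq V -> Prop, k < n ->
    forall w, Y k w <-> exists i, infinitely_often (fun m => W i (pre w m)).
  move=> k; have [ltkn|_] := ltnP k n; last by exists (fun _ _ => True).
  by have [W WP] := omega_regular_sigma03 (reg k ltkn).2; exists W.
exists (fun j h => exists c : nat * nat, [/\ unpickle j = Some c, c.1 < n, X c.1 x & W c.1 c.2 h]).
move=> y; rewrite RE; split=> [[k ltkn [Xk /(WP k ltkn)[i infi]]]|[j infj]].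
  exists (pickle (k, i)) => m; have [l lem Wl] := infi m.
  by exists l => //; exists (k, i); rewrite pickleK.
have [_ _ [[k i] [/= jE ltkn Xk _]]] := infj 0; exists k => //; split=> //.
apply/(WP k ltkn); exists i => m; have [l lem [c [cE _ _ Wl]]] := infj m.
by exists l => //; move: cE Wl; rewrite jE => -[<-].
Qed.

(** What lies above [x] depends only on which sets [X k] contain [x], hence on one of finitely many
    types. The rank of [y] counts the types of words below [y]. *)
Lemma recognizable_rank (V : finType) (R : word V -> word V -> Prop) :
  total_preorder R -> omega_recognizable R ->
  exists N (rho : word V -> nat), (forall x, rho x <= N) /\
    forall x y, R x y <-> rho x <= rho y.
Proof.
move=> [Rxx Rtrans Rtot] [n [X [Y [_ RE]]]].
pose type_of x := [set k : 'I_n | `[< X k x >]].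
have typeE x x' y : type_of x = type_of x' -> R x y -> R x' y.
  move=> eq_t /RE[k ltkn [Xk Yk]]; apply/RE; exists k => //; split=> //.
  have : Ordinal ltkn \in type_of x by rewrite inE; apply/asboolP.
  by rewrite eq_t inE => /asboolP.
pose below y := [set t | `[< exists x, type_of x = t /\ R x y >]].
have belowS x y : R x y -> below x \subset below y.
  move=> Rxy; apply/subsetP => t; rewrite !inE => /asboolP[z [zt Rzx]].
  by apply/asboolP; exists z; split=> //; apply: Rtrans Rxy.
exists #|{set 'I_n}|, (fun y => #|below y|); split=> [x|x y]; first exact: max_card.
split=> [/belowS/subset_leq_card//|le]; apply: contrapT => nRxy.
have Ryx : R y x by case: (Rtot x y).
have : below y \proper below x.
  rewrite properE belowS //=; apply/subsetPn; exists (type_of x); rewrite inE.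
    by apply/asboolP; exists x.
  by apply/asboolP => -[z [zt Rzy]]; apply: nRxy; apply: typeE Rzy.
by move/proper_card; rewrite ltnNge le.
Qed.

Lemma sigma03_threshold (V : finType) (R : word V -> word V -> Prop) (rho : word V -> nat) c :
  omega_recognizable R -> (forall x y, R x y <-> rho x <= rho y) ->
  sigma03 (fun w => c <= rho w).
Proof.
move=> recR RE; have [ex|no] := pselect (exists r, (exists x, rho x = r) /\ c <= r); last first.
  exists (fun _ _ => False) => w; split=> [lec|[k /(_ 0)[]//]].
  by case: no; exists (rho w); split=> //; exists w.
(* For the least attained rank [r] above the threshold, with witness [x], the set is the upper set
   of [x]. *)
have [r [[x rx] lecr] min_r] := ex_least ex.
have [W WP] := sigma03_upper_set x recR; exists W => w; rewrite -WP RE rx.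
split=> [lec|]; last exact: leq_trans.
by rewrite leqNgt; apply/negP => /min_r; apply; split=> //; exists w.
Qed.

(** * Values of histories, switching strategies and punishment *)

Section Equilibrium.
Variables (V P : finType) (E : rel V) (owner : V -> P) (v0 : V).
Variables (rho : P -> word V -> nat) (N : P -> nat).
Hypothesis E_total : arena_ok E.
Hypothesis rho_le : forall i w, rho i w <= N i.
Hypothesis rho_sigma03 : forall i c, sigma03 (fun w => c <= rho i w).

Fixpoint legal (h : seq V) : bool :=
  if h is v :: h' then if h' is u :: _ then E u v && legal h' else true else false.

Definition turn (i : P) (h : seq V) := if h is v :: _ then owner v == i else false.

Lemma legal_no_dead_end : no_dead_end legal.
Proof. by case=> // v h leg; have [v' Evv'] := E_total v; exists v'; rewrite /= Evv'. Qed.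

Definition value_spec i h (c : nat) (s t : strategy V) :=
  [/\ c <= N i, valid (turn i) true legal s, valid (turn i) false legal t,
      forall w, plays (turn i) true legal h s w -> c <= rho i w
    & forall w, plays (turn i) false legal h t w -> rho i w <= c].

(** The value is the largest threshold that player [i] can force; determinacy at the next one gives
    the coalition its strategy. At [N i] itself, [rho_le] bounds every play. *)
Lemma value_exists i h : legal h -> exists c s t, value_spec i h c s t.
Proof.
move=> leg; pose W c := (c <= N i) && `[< win (turn i) true legal h (fun w => c <= rho i w) >].
have nd := legal_no_dead_end.
have exW : exists c, W c.
  exists 0; apply/asboolP; have [s sv] := default_strategy (turn i) true nd leg.
  by exists s.
have bW c : W c -> c <= N i by case/andP.
case: (ex_maxnP exW bW) => c /andP[lec /asboolP[s sv sw]] max_c.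
exists c, s; have [ltc|lec'] := ltnP c (N i); last first.
  have [t tv] := default_strategy (turn i) false nd leg.
  by exists t; split=> // w _; apply: leq_trans lec'.
have [winS|[t tv tw]] := sigma03_determinacy (turn i) nd leg (rho_sigma03 i c.+1).
  by have := max_c c.+1; rewrite /W ltc ltnn asboolT // => /(_ isT).
by exists t; split=> // w /tw/negP; rewrite -leqNgt.
Qed.

Lemma optimal_values : exists val (S C : P -> seq V -> strategy V), forall i h, legal h ->
  value_spec i h (val i h) (S i h) (C i h).
Proof.
suff /choice[f fP] : forall a : P * seq V, exists z : nat * strategy V * strategy V,
    legal a.2 -> value_spec a.1 a.2 z.1.1 z.1.2 z.2.
  exists (fun i h => (f (i, h)).1.1), (fun i h => (f (i, h)).1.2), (fun i h => (f (i, h)).2).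
  by move=> i h; apply: (fP (i, h)).
move=> [i h]; have [leg|nleg] := boolP (legal h); last by exists (0, head v0, head v0).
by have [c [s [t st]]] := value_exists i leg; exists (c, s, t).
Qed.

Section Values.
Variables (val : P -> seq V -> nat) (S C : P -> seq V -> strategy V).
Hypothesis valP : forall i h, legal h -> value_spec i h (val i h) (S i h) (C i h).

(* The history at which player i last adopted a new strategy: she switches exactly
   when the current value exceeds the value her current strategy guarantees. *)
Fixpoint commitment i (h : seq V) : seq V :=
  if h is v :: h' then
    if (h' != [::]) && (val i h <= val i (commitment i h')) then commitment i h' else h
  else [::].

Lemma legal_behead v h : h != [::] -> legal (v :: h) -> legal h.
Proof. by case: h => // u h _ /andP[]. Qed.

Lemma legal_commitment i h : legal h -> legal (commitment i h).
Proof.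
elim: h => // v h IHh leg; rewrite [commitment _ _]/=; case: ifP => // /andP[h0 _].
exact/IHh/(legal_behead h0 leg).
Qed.

(** The committed value [u] never decreases and is bounded by [N i]. Once it is maximal, a single
    strategy is followed for ever, and it guarantees that maximum. *)
Lemma rho_ge_value i w : (forall n, legal (pre w n.+1)) ->
  (forall n, owner (w n) = i ->
     w n.+1 = S i (commitment i (pre w n.+1)) (pre w n.+1)) ->
  forall n, val i (pre w n.+1) <= rho i w.
Proof.
move=> leg follow n; pose u m := val i (commitment i (pre w m.+1)).
have uS m : u m <= u m.+1 /\ (u m.+1 <= u m ->
    commitment i (pre w m.+2) = commitment i (pre w m.+1)).
  have -> : commitment i (pre w m.+2) =
      if val i (pre w m.+2) <= u m then commitment i (pre w m.+1) else pre w m.+2 by [].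
  have -> : u m.+1 = if val i (pre w m.+2) <= u m then u m else val i (pre w m.+2).
    rewrite {1}/u; have -> : commitment i (pre w m.+2) =
      if val i (pre w m.+2) <= u m then commitment i (pre w m.+1) else pre w m.+2 by [].
    by case: ifP.
  have [//|lt] := leqP (val i (pre w m.+2)) (u m).
  by split; [exact: ltnW|rewrite leqNgt lt].
have u_mono m m' : m <= m' -> u m <= u m'.
  by move=> /subnK<-; elim: (m' - m) => // k; move/leq_trans; apply; rewrite addSn; apply: (uS _).1.
have val_u m : val i (pre w m.+1) <= u m.
  rewrite /u /=; case: ifP => [/andP[]|] //.
have uN m : u m <= N i by have [] := valP i (legal_commitment i (leg m)).
have [m max_m] : exists m, forall k, u k <= u m.
  have exr : exists r, `[< exists m, u m = r >] by exists (u 0); apply/asboolP; exists 0.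
  have rN r : `[< exists m, u m = r >] -> r <= N i by move=> /asboolP[m <-].
  case: (ex_maxnP exr rN) => r /asboolP[m mr] max_r; exists m => k; rewrite mr.
  by apply: max_r; apply/asboolP; exists k.
have [{max_m}m max_m min_m] := ex_least (ex_intro (fun m => forall k, u k <= u m) m max_m).
(* The index [m] is the first with maximal [u], so the player commits afresh exactly at
   [pre w m.+1], either because [u] rises there or because [m] is 0. *)
have stable k : m <= k -> commitment i (pre w k.+1) = pre w m.+1.
  move=> /subnK<-; elim: (k - m) => [|d IHd]; last first.
    rewrite -IHd addSn; apply: (uS _).2; apply: leq_trans (max_m _) (u_mono _ _ _).
    exact: leq_addl.
  rewrite add0n; case: (m) max_m min_m => // m' max_m min_m.
  have ltu : u m' < u m'.+1.
    by rewrite ltnNge; apply/negP => le; apply: (min_m m') => // k'; apply: leq_trans le.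
  move: ltu; rewrite /u -[commitment i (pre w m'.+2)]/(if val i (pre w m'.+2) <= u m' then
     commitment i (pre w m'.+1) else pre w m'.+2); case: ifP => //.
  by rewrite ltnn.
have [_ _ _ Sw _] := valP i (leg m).
apply: leq_trans (val_u n) (leq_trans (max_m n) _).
rewrite {1}/u stable //; apply: Sw; split; rewrite size_pre // => -[//|k] ltmk.
by split=> [|/eqP own]; [exact: leg|rewrite follow // stable].
Qed.

Fixpoint equilibrium_hist n : seq V :=
  if n is m.+1 then let h := equilibrium_hist m in
    let i := owner (head v0 h) in S i (commitment i h) h :: h
  else [:: v0].

Definition equilibrium_play n := head v0 (equilibrium_hist n).

Lemma pre_equilibrium_play n : pre equilibrium_play n.+1 = equilibrium_hist n.
Proof.
elim: n => // n IHn.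
by rewrite -[LHS]/(equilibrium_play n.+1 :: pre equilibrium_play n.+1) IHn.
Qed.

Lemma equilibrium_play_follows n i : owner (equilibrium_play n) = i ->
  equilibrium_play n.+1 =
    S i (commitment i (pre equilibrium_play n.+1)) (pre equilibrium_play n.+1).
Proof. by move=> <-; rewrite pre_equilibrium_play. Qed.

Lemma legal_equilibrium_play n : legal (pre equilibrium_play n.+1).
Proof.
rewrite pre_equilibrium_play; elim: n => // n leg.
have [v h_v] : exists v h, equilibrium_hist n = v :: h.
  by rewrite -pre_equilibrium_play; eexists; eexists.
case: h_v => h hv; move: leg; rewrite /= hv => leg.
have [_ Sv _ _ _] := valP (owner v) (legal_commitment (owner v) leg).
exact: (Sv (v :: h) leg (eqxx _)).
Qed.

Definition agreement := last_hit (fun x => x == pre equilibrium_play (size x)).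

(* Histories leaving the equilibrium play at a vertex of player j are met by the
   strategy of the coalition against j. *)
Definition punishing_move h : V :=
  let a := agreement h in
  if a == h then equilibrium_play (size h) else C (owner (head v0 a)) a h.

(** One strategy serves all players, as the history tells who is punished. [rev] passes to histories
    stored latest vertex first; an arbitrary successor is the fallback that keeps every move on an
    edge. *)
Definition equilibrium_strategy : strategy V := fun h =>
  let x := rev h in let v := punishing_move x in
  if E (head v0 x) v then v else xchoose (E_total (head v0 x)).

Lemma equilibrium_strategy_edge h v : E v (equilibrium_strategy (rcons h v)).
Proof.
rewrite /equilibrium_strategy rev_rcons /=; case: ifP => // _.
exact: (xchooseP (E_total v)).
Qed.

Lemma equilibrium_strategy_agree w n :
  (forall k, k <= n -> w k = equilibrium_play k) ->
  equilibrium_strategy (rev (pre w n.+1)) = equilibrium_play n.+1.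
Proof.
move=> agree; have -> : pre w n.+1 = pre equilibrium_play n.+1.
  exact: eq_pre.
rewrite /equilibrium_strategy revK; set x := pre _ _.
have -> : punishing_move x = equilibrium_play n.+1.
  rewrite /punishing_move /agreement /= size_pre eqxx.
  by rewrite -/(pre equilibrium_play n.+1) -/x eqxx.
by have /andP[-> _] := legal_equilibrium_play n.+1.
Qed.

Lemma equilibrium_strategy_punish i w m n :
  (forall k, k <= m -> w k = equilibrium_play k) -> w m.+1 != equilibrium_play m.+1 ->
  owner (w m) = i -> m < n -> legal (pre w n.+1) -> owner (w n) != i ->
  equilibrium_strategy (rev (pre w n.+1)) = C i (pre w m.+1) (pre w n.+1).
Proof.
move=> agree dev own ltmn leg nown.
have eq_wm : pre w m.+1 = pre equilibrium_play m.+1 by exact: eq_pre.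
(* After the deviation no longer prefix lies on the equilibrium play, so the agreement stays frozen
   at [pre w m.+1]. *)
have agr : agreement (pre w n.+1) = pre w m.+1.
  apply: last_hit_pre; rewrite ?size_pre ?eq_wm ?(leqW ltmn) // => k ltk _.
  rewrite size_pre; apply/eqP => eqk; have [/eqP] := pre_agree eqk ltk.
  by rewrite (negPf dev).
have moveE : punishing_move (pre w n.+1) = C i (pre w m.+1) (pre w n.+1).
  rewrite /punishing_move agr; case: eqP => [/(congr1 size)|_].
    by rewrite !size_pre => -[eqmn]; rewrite eqmn ltnn in ltmn.
  by rewrite /= own.
rewrite /equilibrium_strategy revK moveE.
have legm : legal (pre w m.+1) by rewrite eq_wm; apply: legal_equilibrium_play.
have [_ _ Cv _ _] := valP i legm.
have /andP[-> //] := Cv _ leg (negPf nown).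
Qed.
End Values.
End Equilibrium.

Lemma outcome_hist (V P : finType) (owner : V -> P) (sigma : profile V P) v0 n :
  play_hist owner sigma v0 n = rev (pre (outcome owner sigma v0) n.+1).
Proof.
elim: n => // n IHn; set w := outcome _ _ _.
rewrite -[pre w n.+2]/(w n.+1 :: pre w n.+1) rev_cons -IHn.
by rewrite /w /outcome /= last_rcons.
Qed.

Lemma outcomeS (V P : finType) (owner : V -> P) (sigma : profile V P) v0 n :
  let w := outcome owner sigma v0 in
  w n.+1 = sigma (owner (w n)) (rev (pre w n.+1)).
Proof. by move=> w; rewrite {1}/w /outcome /= last_rcons -/(outcome _ _ _ n) outcome_hist. Qed.

Lemma legal_outcome (V P : finType) (E : rel V) (owner : V -> P) (sigma : profile V P) v0 n :
  valid_profile E owner sigma -> legal E (pre (outcome owner sigma v0) n.+1).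
Proof.
move=> valid_s; elim: n => // n IHn.
apply/andP; split=> //; rewrite outcomeS /= rev_cons; exact: valid_s.
Qed.

Theorem theorem18 (V P : finType) (E : rel V) (owner : V -> P)
  (pref : P -> word V -> word V -> Prop) :
  arena_ok E ->
  (forall i, total_preorder (pref i)) ->
  (forall i, omega_recognizable (pref i)) ->
  forall v0 : V, exists sigma : profile V P, nash_equilibrium E owner pref sigma v0.
Proof.
move=> E_total tot rec v0.
have /choice[f fP] : forall i, exists f : nat * (word V -> nat), (forall x, f.2 x <= f.1) /\
    forall x y, pref i x y <-> f.2 x <= f.2 y.
  by move=> i; have [N [rho rhoP]] := recognizable_rank (tot i) (rec i); exists (N, rho).
pose N i := (f i).1; pose rho i := (f i).2.
have rho_le i w : rho i w <= N i by have [le _] := fP i; apply: le.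
have prefE i x y : pref i x y <-> rho i x <= rho i y by have [_ H] := fP i; apply: H.
have rho_sigma i c : sigma03 (fun w => c <= rho i w).
  by apply: sigma03_threshold (rec i) (prefE i).
have [val [S [C valP]]] := optimal_values owner v0 E_total rho_le rho_sigma.
pose w := equilibrium_play owner v0 val S.
pose s := equilibrium_strategy owner v0 E_total val S C.
have w_out n : outcome owner (fun=> s) v0 n = w n.
  suff agree k : k <= n -> outcome owner (fun=> s) v0 k = w k by exact: agree.
  elim: n k => [|n IHn] k; first by rewrite leqn0 => /eqP->.
  rewrite leq_eqVlt => /orP[/eqP->|/IHn//].
  by rewrite outcomeS; apply: (equilibrium_strategy_agree E_total valP).
exists (fun=> s); split=> [i h v _|i tau tau_valid [_]].
  exact: equilibrium_strategy_edge.
apply; apply/prefE; have -> : outcome owner (fun=> s) v0 = w by apply/funext.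
set wd := outcome _ _ _.
have [dev|nodev] := pselect (exists n, wd n <> w n); last first.
  suff -> : wd = w by [].
  by apply/funext => n; apply: contrapT => dn; apply: nodev; exists n.
have leg_d n : legal E (pre wd n.+1).
  apply: legal_outcome => j h v own; rewrite /deviate.
  by have [eqj|_] := eqVneq j i; [apply: tau_valid; rewrite own|exact: equilibrium_strategy_edge].
(* Both plays start at [v0], so they first differ at some [m.+1], through the move made at [m]. *)
have [[//|m] dm min_m] := ex_least dev.
have agree k : k <= m -> wd k = w k by move=> /min_m nk; apply: contrapT.
have follow n : owner (wd n) != i -> wd n.+1 = s (rev (pre wd n.+1)).
  by move=> nown; rewrite {1}/wd outcomeS /deviate (negPf nown).
(* Any other player follows [s], which stays on the equilibrium play as long as the history does. *)
have own : owner (wd m) = i.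
  apply/eqP; apply: contrapT => /negP nown; apply: dm.
  by rewrite follow //; apply: (equilibrium_strategy_agree E_total valP).
(* The coalition holds [wd] to the value at [pre wd m.+1], a history shared with [w], whose rank is
   at least that value. *)
have [_ _ _ _ Cw] := valP i _ (leg_d m).
apply: leq_trans (Cw wd _) _.
  split; rewrite size_pre // => -[//|n] ltmn; split=> [|/negbT nown]; first exact: leg_d.
  have ltmn' : m < n.
    move: ltmn; rewrite ltnS leq_eqVlt => /orP[/eqP eqmn|//].
    by move: nown; rewrite /= -eqmn own eqxx.
  rewrite follow //; apply: (equilibrium_strategy_punish E_total valP) => //; exact/eqP.
rewrite (eq_pre (n := m.+1) agree); apply: (rho_ge_value valP) => [n|n own_n].
  exact: legal_equilibrium_play valP n.
exact: equilibrium_play_follows.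
Qed.
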